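(* Let $S$ be a semigroup. (1) Let $\{A_i,\ i\in I\}$ be a family of medial subsets of $S$ such that $A=\bigcap_{i\in I}Sep(A_i)$ is not empty. Then $P_{\{A_i,\ i\in I\}}$ is a commutative monoid congruence of $S$, and $A$ is a $P_{\{A_i,\ i\in I\}}$-class which is the identity element of the factor semigroup $S/P_{\{A_i,\ i\in I\}}$. (2) Conversely, for every commutative monoid congruence $\sigma$ of $S$ there is a family $\{A_i,\ i\in I\}$ of medial subsets of $S$ such that $\bigcap_{i\in I}Sep(A_i)\neq\emptyset$ and $\sigma=P_{\{A_i,\ i\in I\}}$.
   Context: For a subset $A$ of a semigroup $S$, let $\overline{A}=S\setminus A$. The separator $Sep(A)$ of $A$ is the set of all $x\in S$ such that $xA\subseteq A$, $Ax\subseteq A$, $x\overline{A}\subseteq\overline{A}$ and $\overline{A}x\subseteq\overline{A}$. A subset $A$ of $S$ is called medial if, for all $a,b,x,y\in S$, $xaby\in A$ if and only if $xbay\in A$. For a family $\{A_i,\ i\in I\}$ of subsets of $S$, the relation $P_{\{A_i,\ i\in I\}}$ on $S$ is defined by: $(a,b)\in P_{\{A_i,\ i\in I\}}$ if and only if, for every $i\in I$ and all $x,y\in S$, $xay\in A_i\Leftrightarrow xby\in A_i$. (This relation is a congruence of $S$.) A congruence $\sigma$ of $S$ is called a monoid congruence (respectively, a commutative monoid congruence) if the factor semigroup $S/\sigma$ is a monoid, i.e. has an identity element (respectively, is a commutative monoid). *)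

(* Defs.v *)
(* MathComp, with the classical sets and axioms of mathcomp-classical. *)
From Stdlib Require Import RelationClasses.
From HB Require Import structures.
From mathcomp Require Import all_boot.
From mathcomp Require Import boolp classical_sets.

Set Implicit Arguments.
Unset Strict Implicit.
Unset Printing Implicit Defensive.

Local Open Scope classical_set_scope.
Local Open Scope quotient_scope.
Local Open Scope group_scope.

(* A [semigroupType] carries a [choiceType] structure. This costs no generality:
   by constructive indefinite description every type has one ([gen_choiceMixin]). *)

Definition separator (S : semigroupType) (A : set S) : set S :=
  [set x | [/\ [set x * a | a in A] `<=` A,
               [set a * x | a in A] `<=` A,
               [set x * b | b in ~` A] `<=` ~` A &
               [set b * x | b in ~` A] `<=` ~` A]].

Definition medial (S : semigroupType) (A : set S) : Prop :=
  forall a b x y : S, A (x * a * b * y) <-> A (x * b * a * y).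

Record congruence (S : semigroupType) := Congruence {
  congr_rel :> S -> S -> Prop;
  congr_equiv : Equivalence congr_rel;
  congr_mull : forall s a b, congr_rel a b -> congr_rel (s * a) (s * b);
  congr_mulr : forall s a b, congr_rel a b -> congr_rel (a * s) (b * s) }.

Section FactorSemigroup.
Variables (S : semigroupType) (sigma : congruence S).

Definition congr_relb : rel S := fun a b => `[< sigma a b >].

Lemma congr_relb_equiv : equiv_class_of congr_relb.
Proof.
have [r s t] := congr_equiv sigma.
split=> [a|a b|b a c].
- exact/asboolP/r.
- by apply/idP/idP => /asboolP h; apply/asboolP/s.
- by move=> /asboolP ab /asboolP bc; apply/asboolP/(t _ _ _ ab bc).
Qed.

Definition congr_equiv_rel : equiv_rel S := EquivRelPack congr_relb_equiv.

Definition factor := {eq_quot congr_equiv_rel}.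

HB.instance Definition _ := Choice.on factor.
HB.instance Definition _ := EqQuotient.on factor.

Lemma factor_eqP (a b : S) : \pi_factor a = \pi_factor b <-> sigma a b.
Proof. by split=> [/eqmodP/asboolP|h]; [|apply/eqmodP/asboolP]. Qed.

Definition factor_mul (c d : factor) : factor := \pi_factor (repr c * repr d).

Lemma factor_mulE (a b : S) :
  factor_mul (\pi_factor a) (\pi_factor b) = \pi_factor (a * b).
Proof.
have [_ _ t] := congr_equiv sigma.
apply/factor_eqP; apply: (t _ (a * repr (\pi_factor b))).
- by apply: congr_mulr; apply: (iffLR (factor_eqP _ _)); rewrite reprK.
- by apply: congr_mull; apply: (iffLR (factor_eqP _ _)); rewrite reprK.
Qed.

Lemma factor_mulA : associative factor_mul.
Proof.
elim/quotW=> a; elim/quotW=> b; elim/quotW=> c.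
by rewrite (factor_mulE b c) (factor_mulE a b) !factor_mulE mulgA.
Qed.

HB.instance Definition _ := isSemigroup.Build factor factor_mulA.

(* The congruence class of which the element [c] of the factor semigroup consists. *)
Definition class_of_factor (c : factor) : set S := \pi_factor @^-1` [set c].

End FactorSemigroup.

Definition is_identity (M : semigroupType) (e : M) : Prop :=
  forall c : M, e * c = c /\ c * e = c.

Definition monoid_congruence (S : semigroupType) (sigma : congruence S) : Prop :=
  exists e : factor sigma, is_identity e.

Definition commutative_monoid_congruence (S : semigroupType)
    (sigma : congruence S) : Prop :=
  monoid_congruence sigma /\ (forall c d : factor sigma, c * d = d * c).

Section FamilyCongruence.
Variables (S : semigroupType) (I : Type) (A_ : I -> set S).

Definition P_rel (a b : S) : Prop :=
  forall (i : I) (x y : S), A_ i (x * a * y) <-> A_ i (x * b * y).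

Lemma P_rel_equiv : Equivalence P_rel.
Proof.
split=> [a i x y //|a b ab i x y|a b c ab bc i x y].
- by rewrite ab.
- by rewrite ab bc.
Qed.

Lemma P_rel_mull s a b : P_rel a b -> P_rel (s * a) (s * b).
Proof. by move=> ab i x y; rewrite !mulgA; apply: ab. Qed.

Lemma P_rel_mulr s a b : P_rel a b -> P_rel (a * s) (b * s).
Proof. by move=> ab i x y; rewrite !mulgA -!(mulgA _ s y); apply: ab. Qed.

Definition P_congruence : congruence S :=
  Congruence P_rel_equiv P_rel_mull P_rel_mulr.

End FamilyCongruence.

(* Main.v *)
Require Import Defs.
From mathcomp Require Import all_boot.
From mathcomp Require Import boolp classical_sets.

Local Open Scope classical_set_scope.
Local Open Scope quotient_scope.

(** An element of Sep(A), for A medial, can be moved to the front of a product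
    and cancelled there, so it may be inserted anywhere without changing
    membership in A; this is what makes it an identity modulo P.  Conversely, a
    commutative monoid congruence is recovered from the family of all its
    classes, multiplying by an identity on both sides to absorb the contexts
    x _ y in the definition of P. *)

(** By contraposition, the inclusions for the complement of [A] are converses of those for [A], so
    the four conditions pair up into two equivalences, usable for rewriting in either direction. *)
Lemma separatorP {S : semigroupType} {A : set S} {z : S} :
  separator A z <->
  forall a : S, (A (z * a)%g <-> A a) /\ (A (a * z)%g <-> A a).
Proof.
split=> [[zA Az zB Bz] a|h].
  split; split.
  - by move=> Aza; apply: contrapT => nAa; apply: (zB (z * a)%g) => //; exists a.
  - by move=> Aa; apply: zA; exists a.
  - by move=> Aaz; apply: contrapT => nAa; apply: (Bz (a * z)%g) => //; exists a.
  - by move=> Aa; apply: Az; exists a.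
by split=> _ [a Aa <-] /=; rewrite ?(h a).1 ?(h a).2.
Qed.

Lemma medial_separator_insert {S : semigroupType} {A : set S} {z : S} (x y : S) :
  medial A -> separator A z -> A (x * z * y)%g <-> A (x * y)%g.
Proof.
move=> mA /separatorP sz.
(* Mediality swaps interior factors only, so a leading [z] is added first: [z * x * z * y] becomes
   [z * z * x * y], and both copies of [z] cancel. *)
by rewrite -(sz _).1 !mulgA mA -!mulgA !(sz _).1.
Qed.

Section MedialFamily.
Context {S : semigroupType} {I : Type} {A_ : I -> set S}.
Context (mA : forall i, medial (A_ i)).

Lemma P_rel_mulC (a b : S) : P_rel A_ (a * b)%g (b * a)%g.
Proof. by move=> i x y; rewrite !mulgA; apply: mA. Qed.

Lemma P_rel_separator_mull (e a : S) :
  (\bigcap_i separator (A_ i)) e -> P_rel A_ (e * a)%g a.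
Proof.
move=> se i x y; rewrite mulgA -!mulgA (mulgA x e) medial_separator_insert //.
exact: se.
Qed.

Lemma P_rel_separator {e z : S} : (\bigcap_i separator (A_ i)) e ->
  P_rel A_ z e <-> (\bigcap_i separator (A_ i)) z.
Proof.
move=> se; split=> [ze i _|sz i x y].
  have /separatorP sei := se i Logic.I.
  apply/separatorP => a; split.
  (* [P_rel] compares [z] and [e] only between two factors; an extra [e] supplies the missing one
     and is cancelled at the end. *)
  - by rewrite -(sei _).1 mulgA (ze i) -mulgA !(sei _).1.
  - by rewrite -(sei _).2 (ze i) !(sei _).2.
by rewrite !medial_separator_insert //; [exact: se|exact: sz].
Qed.

End MedialFamily.

Lemma pi_factorM {S : semigroupType} (sigma : congruence S) (a b : S) :
  (\pi_(factor sigma) a * \pi_(factor sigma) b)%g = \pi_(factor sigma) (a * b)%g.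
Proof. exact: factor_mulE. Qed.

Lemma medial_family_congruence (S : semigroupType) (I : Type)
    (A_ : I -> set S) :
  (forall i : I, medial (A_ i)) ->
  \bigcap_i separator (A_ i) !=set0 ->
  commutative_monoid_congruence (P_congruence A_) /\
  exists c : factor (P_congruence A_),
    class_of_factor c = \bigcap_i separator (A_ i) /\ is_identity c.
Proof.
move=> mA [e se].
(* Commutativity comes first, since it reduces the identity law to one side. *)
have mulC (c d : factor (P_congruence A_)) : (c * d = d * c)%g.
  elim/quotW: c => a; elim/quotW: d => b.
  by rewrite !pi_factorM; apply/factor_eqP/P_rel_mulC.
have id_e : is_identity (\pi_(factor (P_congruence A_)) e).
  move=> c; rewrite (mulC c); split; elim/quotW: c => a;
  by rewrite pi_factorM; apply/factor_eqP/P_rel_separator_mull.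
split; first by split=> //; exists (\pi_(factor (P_congruence A_)) e).
exists (\pi_(factor (P_congruence A_)) e); split=> //.
apply/seteqP; split=> z.
- by move=> /factor_eqP /(P_rel_separator mA se).
- by move=> /(P_rel_separator mA se) ze; apply/factor_eqP.
Qed.

(** Indexing the classes by the elements of [S] repeats classes but avoids choosing
    representatives. *)
Lemma commutative_monoid_congruence_classes (S : semigroupType)
    (sigma : congruence S) :
  commutative_monoid_congruence sigma ->
  [/\ forall i : S, medial (sigma i : set S),
      \bigcap_i separator (sigma i : set S) !=set0 &
      forall a b : S, sigma a b <-> P_congruence (sigma : S -> set S) a b].
Proof.
case=> -[e id_e] mulC.
have [r s t] := congr_equiv sigma.
elim/quotW: e id_e => e id_e.
have sC a b : sigma (a * b)%g (b * a)%g.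
  by apply/factor_eqP; rewrite -!pi_factorM; apply: mulC.
have se a : sigma (e * a)%g a.
  by apply/factor_eqP; rewrite -pi_factorM; apply: (id_e _).1.
have se' a : sigma (a * e)%g a by apply: t (sC a e) (se a).
have sE i a b : sigma a b -> sigma i a <-> sigma i b.
  by move=> ab; split=> h; [apply: t h ab|apply: t h (s _ _ ab)].
split.
- move=> i a b x y; apply/sE/congr_mulr.
  by rewrite -!mulgA; apply/congr_mull.
(* Multiplying by [e] never moves an element to another class, so [e] lies in every separator. *)
- exists e => i _; apply/separatorP => a; split; exact/sE.
move=> a b; split=> [ab i x y|Pab].
  by apply/sE/congr_mulr/congr_mull.
have see c : sigma (e * c * e)%g c by apply: t (se' _) (se _).
(* The class of [a] is the test set: it contains [e * a * e], hence by [Pab] also [e * b * e], and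
   therefore [b]. *)
apply/(sE _ _ _ (see b))/(Pab a e e)/(sE _ _ _ (see a))/r.
Qed.

Theorem theorem1 (S : semigroupType) :
  (forall (I : Type) (A_ : I -> set S),
     (forall i : I, medial (A_ i)) ->
     \bigcap_i separator (A_ i) !=set0 ->
     commutative_monoid_congruence (P_congruence A_) /\
     exists c : factor (P_congruence A_),
       class_of_factor c = \bigcap_i separator (A_ i) /\ is_identity c)
  /\
  (forall sigma : congruence S,
     commutative_monoid_congruence sigma ->
     exists (I : Type) (A_ : I -> set S),
       [/\ forall i : I, medial (A_ i),
           \bigcap_i separator (A_ i) !=set0 &
           forall a b : S, sigma a b <-> P_congruence A_ a b]).
Proof.
split; first exact: medial_family_congruence.
move=> sigma /commutative_monoid_congruence_classes h.
by exists S, (sigma : S -> set S).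
Qed.
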